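(* Let $\mathcal{A}$ be a countable structure. Then ZFA-Axiom CSP holds in $\mathbf{ZFA}(\mathcal{A})$, that is, for every finite set $X\subseteq A$ of atoms, every $X$-equivariant constraint satisfaction problem in $\mathbf{ZFA}(\mathcal{A})$ with finite domain has an $X$-equivariant solution if and only if it has a solution, if and only if the topological group $\mathrm{Aut}(\mathcal{A})$ is extremely amenable.
   Context: Sets with atoms. Let $\mathcal{A}$ be a (single-sorted) structure with universe $A$ (the elements of $A$ are treated as atoms). Put $V_0(\mathcal{A})=A$, $V_{\alpha+1}(\mathcal{A})=\mathcal{P}(V_\alpha(\mathcal{A}))\cup V_\alpha(\mathcal{A})$, $V_\lambda(\mathcal{A})=\bigcup_{\alpha<\lambda}V_\alpha(\mathcal{A})$ for limit $\lambda$, and $V(\mathcal{A})=\bigcup_{\alpha}V_\alpha(\mathcal{A})$. The group $\mathrm{Aut}(\mathcal{A})$ acts on $V(\mathcal{A})$ by applying automorphisms to atoms, hereditarily. For $X\in V(\mathcal{A})$ let $\mathrm{Aut}(\mathcal{A})_X=\{\pi: \pi\bullet X=X\}$. Give $\mathrm{Aut}(\mathcal{A})$ the topology inherited from the product topology on $A^A$ ($A$ discrete); a subgroup is open iff it contains the pointwise stabiliser $\mathrm{Aut}(\mathcal{A})_{(A_0)}$ of some finite $A_0\subseteq A$. A set $X\in V(\mathcal{A})$ is symmetric if $\mathrm{Aut}(\mathcal{A})_Y$ is open for every $Y\in^* X$, where $\in^*$ is the reflexive-transitive closure of $\in$. $\mathbf{ZFA}(\mathcal{A})$ is the sub-hierarchy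 of $V(\mathcal{A})$ of symmetric sets. For finite $A_0\subseteq A$, a symmetric set $X$ is $A_0$-equivariant if $\mathrm{Aut}(\mathcal{A})_{(A_0)}\subseteq \mathrm{Aut}(\mathcal{A})_X$. CSP. A constraint satisfaction problem (CSP) is a triple $\langle D,V,C\rangle$, where $D$ is a set (the domain), $V$ is a set (the variables), and $C$ is a set of constraints of the form $\langle\langle x_1,\dots,x_k\rangle,R\rangle$ with $k$ a natural number, $x_i\in V$ and $R\subseteq D^k$. A solution is a function $S:V\to D$ (any function, i.e. an element of $V(\mathcal{A})$, not necessarily symmetric) such that $\langle S(x_1),\dots,S(x_k)\rangle\in R$ for every $\langle\langle x_1,\dots,x_k\rangle,R\rangle\in C$. The CSP is $X$-equivariant if $D,V,C$ are $X$-equivariant sets in $\mathbf{ZFA}(\mathcal{A})$; a solution $S$ is $X$-equivariant if its graph is an $X$-equivariant set. Extreme amenability. A topological group $G$ is extremely amenable if every continuous action $G\times X\to X$ on a non-empty compact Hausdorff space $X$ has a fixed point. *)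

(* Defs.v *)
From Stdlib Require Relation_Operators.
From HB Require Import structures.
From mathcomp Require Import all_boot.
From mathcomp Require Import all_classical topology.

Set Implicit Arguments.
Unset Strict Implicit.
Unset Printing Implicit Defensive.

Local Open Scope classical_set_scope.

HB.mixin Record isTopologicalGroup G & Topological G & Group G := {
  mulg_continuous : continuous (fun gh : G * G => (gh.1 * gh.2)%g);
  invg_continuous : continuous (fun g : G => (g^-1)%g)
}.

#[short(type="topologicalGroupType")]
HB.structure Definition TopologicalGroup :=
  {G of isTopologicalGroup G & Topological G & Group G}.

Record continuous_action (G : topologicalGroupType) (T : topologicalType)
    (act : G -> T -> T) : Prop := ContinuousAction {
  act1 : forall x, act 1%g x = x;
  actM : forall g h x, act (g * h)%g x = act g (act h x);
  act_continuous : continuous (fun gx : G * T => act gx.1 gx.2)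
}.

Definition extremely_amenable (G : topologicalGroupType) : Prop :=
  forall (T : topologicalType) (act : G -> T -> T),
    [set: T] !=set0 -> compact [set: T] -> hausdorff_space T ->
    continuous_action act ->
    exists x, forall g, act g x = x.

Record signature := Signature {
  rel_symbol : Type;
  rel_arity : rel_symbol -> nat;
  fun_symbol : Type;
  fun_arity : fun_symbol -> nat
}.

Record structure (L : signature) := Structure {
  carrier :> Type;
  rel_interp : forall r : rel_symbol L,
    ('I_(rel_arity r) -> carrier) -> Prop;
  fun_interp : forall f : fun_symbol L,
    ('I_(fun_arity f) -> carrier) -> carrier
}.

Record Aut (L : signature) (A : structure L) := Automorphism {
  aut_fun :> A -> A;
  aut_bij : bijective aut_fun;
  aut_rel : forall (r : rel_symbol L) (x : 'I_(rel_arity r) -> A),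
    rel_interp (aut_fun \o x) <-> rel_interp x;
  aut_fun_interp : forall (f : fun_symbol L) (x : 'I_(fun_arity f) -> A),
    aut_fun (fun_interp x) = fun_interp (aut_fun \o x)
}.

Section AutGroup.
Variables (L : signature) (A : structure L).
Implicit Types p q : Aut A.

Lemma autP p q : p =1 q -> p = q.
Proof.
case: p q => [f bf rf ff] [g bg rg fg] /= /funext fg_eq.
by case: _ / fg_eq in bg rg fg *; congr Automorphism; exact: Prop_irrelevance.
Qed.

Definition aut_id : Aut A.
Proof. by exists id => //; exists id. Defined.

Definition aut_comp p q : Aut A.
Proof.
exists (p \o q).
- exact: bij_comp (aut_bij p) (aut_bij q).
- move=> r x; have -> : (p \o q) \o x = p \o (q \o x) by [].
  by rewrite !aut_rel.
- by move=> f x /=; rewrite !aut_fun_interp.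
Defined.

Lemma aut_inv_subproof p : exists q, cancel p q /\ cancel q p.
Proof.
case: (aut_bij p) => g pK gK.
have pg n (x : 'I_n -> A) : p \o (g \o x) = x by apply/funext => i /=.
suff [q qE] : exists q : Aut A, q =1 g.
  by exists q; split=> x; rewrite ?qE.
unshelve eexists (@Automorphism L A g _ _ _) => //.
- by exists p.
- by move=> r x; rewrite -(aut_rel p) pg.
- by move=> f x; apply: (can_inj pK); rewrite gK aut_fun_interp pg.
Qed.

Definition aut_inv p : Aut A := sval (cid (aut_inv_subproof p)).

Lemma aut_invK p : cancel p (aut_inv p).
Proof. by rewrite /aut_inv; case: cid => q []. Qed.

Lemma aut_invKV p : cancel (aut_inv p) p.
Proof. by rewrite /aut_inv; case: cid => q []. Qed.

HB.instance Definition _ := gen_eqMixin (Aut A).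
HB.instance Definition _ := gen_choiceMixin (Aut A).

Lemma aut_compA : associative aut_comp.
Proof. by move=> p q r; apply: autP. Qed.
Lemma aut_comp1 : left_id aut_id aut_comp.
Proof. by move=> p; apply: autP. Qed.
Lemma aut_compr1 : right_id aut_id aut_comp.
Proof. by move=> p; apply: autP. Qed.
Lemma aut_compV : left_inverse aut_id aut_inv aut_comp.
Proof. by move=> p; apply: autP => x /=; rewrite aut_invK. Qed.
Lemma aut_comprV : right_inverse aut_id aut_inv aut_comp.
Proof. by move=> p; apply: autP => x /=; rewrite aut_invKV. Qed.

HB.instance Definition _ :=
  isGroup.Build (Aut A) aut_compA aut_comp1 aut_compr1 aut_compV aut_comprV.

(* [{classic A}] is convertible to [A], with a (classical) choice structure. *)
Definition aut_to_prod p :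
  {ptws {classic A} -> discrete_topology {classic A}} := p.

HB.instance Definition _ :=
  Topological.copy (Aut A) (initial_topology aut_to_prod).

Lemma near_aut p (a : A) : nbhs p [set q : Aut A | q a = p a].
Proof.
have pc : continuous
    ((@proj {classic A} (fun=> discrete_topology {classic A}) a)
       \o (aut_to_prod : Aut A -> _)).
  move=> q; apply: continuous_comp; first exact: initial_continuous.
  exact: proj_continuous.
by have := pc p [set p a]; apply; exact: discrete_set1.
Qed.

Lemma continuous_aut (T : topologicalType) (f : T -> Aut A) :
  (forall x (a : A), \forall y \near x, f y a = f x a) -> continuous f.
Proof.
move=> fP; apply: continuous_comp_initial => x.
apply/cvg_sup => a U [/= _ [[W oW <-] /= Wfx WU]].
apply: filterS (fP x a) => y fyx; apply: WU.
by rewrite /= /proj /= /aut_to_prod fyx.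
Qed.

Lemma aut_mul_continuous : continuous (fun pq : Aut A * Aut A => (pq.1 * pq.2)%g).
Proof.
apply: continuous_aut => -[p q] a.
exists ([set p' : Aut A | p' (q a) = p (q a)], [set q' : Aut A | q' a = q a]).
  by split; exact: near_aut.
by move=> -[p' q'] /= [p'E q'E]; rewrite q'E p'E.
Qed.

Lemma aut_inv_continuous : continuous (fun p : Aut A => (p^-1)%g).
Proof.
apply: continuous_aut => p a.
apply: filterS (near_aut p (aut_inv p a)) => q /=; rewrite aut_invKV => qE.
by rewrite -[in LHS]qE; exact: aut_invK.
Qed.

HB.instance Definition _ :=
  isTopologicalGroup.Build (Aut A) aut_mul_continuous aut_inv_continuous.

End AutGroup.

(* Well-founded trees, taken up to the extensional equality [veq], are the
   cumulative hierarchy over the set of atoms [A]: [vsup f] is the set of the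
   [f i], and its rank is the supremum of the ranks of the [f i] plus one. *)
Inductive vset (A : Type) : Type :=
| vatom (a : A)
| vsup (I : Type) (f : I -> vset A).

Section Vset.
Variable A : Type.
Implicit Types x y z : vset A.

(* An atom is never equal to a set, not even to the empty one. *)
Fixpoint veq x y : Prop :=
  match x, y with
  | vatom a, vatom b => a = b
  | vsup _ f, vsup _ g => (forall i, exists j, veq (f i) (g j)) /\
                          (forall j, exists i, veq (f i) (g j))
  | _, _ => False
  end.

Definition vmem x y : Prop :=
  if y is vsup _ f then exists i, veq x (f i) else False.

Definition vmem_star : vset A -> vset A -> Prop :=
  Relation_Operators.clos_refl_trans (vset A) vmem.

Definition is_set x : Prop := if x is vsup _ _ then True else False.

(* [V_0]; having it as a set puts [A] in the universe of the index types. *)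
Definition vatoms : vset A := vsup (@vatom A).

Definition vempty : vset A := vsup (fun i : void => of_void (vset A) i).
Definition vpair2 x y : vset A := vsup (fun b : bool => if b then x else y).

(* Kuratowski pair {{x}, {x, y}}. *)
Definition vpair x y : vset A := vpair2 (vpair2 x x) (vpair2 x y).

(* <x_1, ..., x_k> = (x_1, (x_2, ... (x_k, empty))); as a pair is never empty,
   a tuple determines its length, which nested pairs ending in x_k would not. *)
Definition vtuple (k : nat) (x : 'I_k -> vset A) : vset A :=
  foldr vpair vempty [seq x i | i <- enum 'I_k].

Definition vfinite x : Prop :=
  exists (n : nat) (f : 'I_n -> vset A),
    forall y, vmem y x -> exists i, veq y (f i).

Definition is_function S X Y : Prop :=
  [/\ is_set S,
      forall p, vmem p S ->
        exists x y, [/\ vmem x X, vmem y Y & veq p (vpair x y)],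
      forall x, vmem x X -> exists y, vmem (vpair x y) S &
      forall x y z, vmem (vpair x y) S -> vmem (vpair x z) S -> veq y z].

Definition is_relation_on (D : vset A) (k : nat) (R : vset A) : Prop :=
  is_set R /\
  forall t, vmem t R -> exists d : 'I_k -> vset A,
    (forall i, vmem (d i) D) /\ veq t (vtuple d).

Record csp := CSP {
  csp_dom : vset A;
  csp_var : vset A;
  csp_con : vset A;
  csp_dom_set : is_set csp_dom;
  csp_var_set : is_set csp_var;
  csp_con_set : is_set csp_con;
  csp_conP : forall c, vmem c csp_con ->
    exists (k : nat) (x : 'I_k -> vset A) (R : vset A),
      [/\ forall i, vmem (x i) csp_var,
          is_relation_on csp_dom k R &
          veq c (vpair (vtuple x) R)]
}.

(* [d] is the tuple <S(x_1), ..., S(x_k)>. *)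
Definition is_solution (P : csp) (S : vset A) : Prop :=
  is_function S (csp_var P) (csp_dom P) /\
  forall (k : nat) (x : 'I_k -> vset A) (R : vset A),
    vmem (vpair (vtuple x) R) (csp_con P) ->
    exists d : 'I_k -> vset A,
      (forall i, vmem (vpair (x i) (d i)) S) /\ vmem (vtuple d) R.

End Vset.

Fixpoint vmap (A B : Type) (f : A -> B) (x : vset A) : vset B :=
  match x with
  | vatom a => vatom (f a)
  | vsup _ g => vsup (fun i => vmap f (g i))
  end.

Section Symmetric.
Variables (L : signature) (A : structure L).

Definition stabiliser (x : vset A) : set (Aut A) :=
  [set p | veq (vmap p x) x].

Definition pointwise_stabiliser (A0 : set A) : set (Aut A) :=
  [set p | forall a, A0 a -> p a = a].

(* [x] belongs to ZFA(A). *)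
Definition symmetric (x : vset A) : Prop :=
  forall y, vmem_star y x -> open (stabiliser y).

Definition equivariant (A0 : set A) (x : vset A) : Prop :=
  symmetric x /\ pointwise_stabiliser A0 `<=` stabiliser x.

Definition equivariant_csp (A0 : set A) (P : csp A) : Prop :=
  [/\ equivariant A0 (csp_dom P), equivariant A0 (csp_var P) &
      equivariant A0 (csp_con P)].

Definition ZFA_axiom_CSP : Prop :=
  forall X : set A, finite_set X ->
  forall P : csp A, equivariant_csp X P -> vfinite (csp_dom P) ->
    ((exists S, is_solution P S /\ equivariant X S) <->
     (exists S, is_solution P S)).

End Symmetric.

(* Main.v *)
Require Import Defs.
From mathcomp Require Import all_boot.
From mathcomp Require Import all_classical topology.
From Stdlib Require List.
From Stdlib Require Import Relation_Operators Operators_Properties.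

(**
Put G = Aut(A).

If G is extremely amenable, let S0 be a solution of an X-equivariant problem
with finite domain, and let H be the open pointwise stabiliser of X.  The fixed
point is needed for H, not for G, so one lets G act on the coinduced space of
the families (e_g) of solutions, indexed by g in G, such that
e_(gh) = h^-1 e_g for h in H.  This space is compact, and it is non-empty since
S0 can be transported along a transversal of G/H.  A family fixed by G is
constant, and its value is an H-invariant solution.

Conversely, suppose that a compact Hausdorff G-space T has no fixed point.  By
compactness there are a finite open cover U_1, .., U_n of T, elements g_j with
g_j U_j disjoint from U_j, and a tuple v of atoms such that each orbit of the
stabiliser of v is contained in some U_j.  Fix x0 in T.  Colour the points p v
of the orbit of v by some j such that U_j contains the orbit of p^-1 x0 under
the stabiliser of v.  Then p v and (p g_j^-1) v never both have colour j.
This is an equivariant constraint satisfaction problem, which has no invariant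
solution since G is transitive on the variables.
*)

Set Implicit Arguments.
Unset Strict Implicit.
Unset Printing Implicit Defensive.

Local Open Scope classical_set_scope.

(** * Fixed colourings under extremely amenable groups *)

Section TopologicalGroups.
Variable G : topologicalGroupType.
Implicit Type g : G.

Lemma inv_continuous : continuous (fun g : G => (g^-1)%g).
Proof. exact: invg_continuous. Qed.

Lemma mul_continuous : continuous (fun gh : G * G => (gh.1 * gh.2)%g).
Proof. exact: mulg_continuous. Qed.

Lemma cvg_mul (T : Type) (F : set_system T) (f h : T -> G) (a b : G) :
  Filter F -> f @ F --> a -> h @ F --> b ->
  (fun x => f x * h x)%g @ F --> (a * b)%g.
Proof.
move=> FF; apply: (@continuous2_cvg _ _ _ _ _ FF _ _ (fun g k : G => (g * k)%g)).
exact: (@mul_continuous (a, b)).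
Qed.

Lemma cvg_mulV1 g : (fun k => (k^-1 * g)%g) @ g --> (1%g : G).
Proof.
by rewrite -(mulVg g); apply: cvg_mul; [exact: inv_continuous|exact: cvg_cst].
Qed.

Lemma cvg_conj1 g : (fun u => (g^-1 * u * g)%g) @ (1%g : G) --> (1%g : G).
Proof.
rewrite -[X in _ --> X](mulVg g) -[in X in _ --> X](mulg1 (g^-1)%g).
apply: cvg_mul; last exact: cvg_cst.
by apply: cvg_mul; [exact: cvg_cst|exact: cvg_id].
Qed.
End TopologicalGroups.

(** Compactness is used in its near-covering form: a predicate on the subtype is extended to [T] by
    quantifying over the proofs of membership in [K]. *)
Lemma closed_subtype_compact (T : topologicalType) (K : set T) :
  compact [set: T] -> closed K -> compact [set: set_type K].
Proof.
move=> cT clK; have cK := subclosed_compact clK cT (@subsetT _ _).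
apply/compact_near_coveringP => I F P FF Pnear.
apply: filterS ((compact_near_coveringP K).1 cK I F
  (fun i x => forall Kx : x \in K, P i (SigSub Kx)) FF _) => [i Pi x _|x Kx].
  have xE : SigSub (mem_set (set_valP x)) = x by exact: val_inj.
  by rewrite -xE; exact: Pi (set_valP x) _.
have [[U V] /= [[_ [[W oW <-] /= Wx WU]] FV] UVP] := Pnear (SigSub (mem_set Kx)) Logic.I.
exists (W, V); first by split => //; exact: open_nbhs_nbhs.
by move=> [y i] [/= Wy Vi] Ky; apply: (UVP (SigSub Ky, i)); split => //; exact: WU.
Qed.

Lemma subtype_hausdorff (T : topologicalType) (K : set T) :
  hausdorff_space T -> hausdorff_space (set_type K).
Proof.
move=> hT x y xy; apply: val_inj; apply: hT => U V Ux Vy.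
have [z [Uz Vz]] := xy _ _ (@initial_continuous _ _ (@set_val T K) x _ Ux)
   (@initial_continuous _ _ (@set_val T K) y _ Vy).
by exists (set_val z).
Qed.

Section Colourings.
Variables (J : Type) (n : nat).

Definition colouring := {ptws {classic J} -> discrete_topology 'I_n}.

Lemma colouring_near (e : colouring) (j : J) :
  nbhs e [set e' : colouring | e' j = e j].
Proof.
have pc : continuous
    (@proj {classic J} (fun=> discrete_topology 'I_n) j : colouring -> _).
  exact: proj_continuous.
exact: (pc e [set e j : discrete_topology 'I_n] (discrete_set1 _)).
Qed.

Lemma colouring_cvg (F : set_system colouring) (e : colouring) : Filter F ->
  (forall j, F [set e' | e' j = e j]) -> F --> e.
Proof.
move=> FF Fe; apply/cvg_sup => j U [/= _ [[W oW <-] /= We WU]].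
by apply: filterS (Fe j) => e' /= e'j; apply: WU; rewrite /= /proj e'j.
Qed.

Lemma colouring_compact : compact [set: colouring].
Proof.
have := @tychonoff {classic J} (fun=> discrete_topology 'I_n) (fun=> setT) _.
rewrite (_ : [set f | _] = setT); last by apply/seteqP; split.
by apply => j; apply: finite_compact; exact: (@finite_finset 'I_n).
Qed.

Lemma colouring_hausdorff : hausdorff_space colouring.
Proof. by apply: hausdorff_product => j; exact: discrete_hausdorff. Qed.

(** A basic neighbourhood in the product topology constrains only finitely many values. Hence
    conditions that each read finitely many values cut out a closed set. *)
Lemma colouring_closed (K : set colouring) :
  (forall e : colouring,
    (forall (m : nat) (j : 'I_m -> J),
      exists2 e', K e' & forall l, e' (j l) = e (j l)) -> K e) ->
  closed K.
Proof.
move=> clK e eK; apply: clK => m j.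
have [e' [Ke' e'E]] := eK _ (@filter_forall _ 'I_m _ (nbhs e) _
  (fun l => colouring_near e (j l))).
by exists e'.
Qed.

End Colourings.

Section Translation.
Variables (G : topologicalGroupType) (I : Type) (n : nat).
Local Notation col := (colouring (G * I) n).

Definition translate (k : G) (e : col) : col :=
  fun j => e ((k^-1 * j.1)%g, j.2).

(** Translation acts on the compact space [K]. The last hypothesis, local constancy in [g] uniformly
    over [K], yields joint continuity of this action. A colouring fixed by all translations does not
    depend on the group coordinate. *)
Lemma extremely_amenable_colouring (K : set col) :
  extremely_amenable G -> K !=set0 -> closed K ->
  (forall k e, K e -> K (translate k e)) ->
  (forall g i, \forall u \near (1%g : G),
     forall e, K e -> e ((u * g)%g, i) = e (g, i)) ->
  exists2 e, K e & forall g i, e (g, i) = e (1%g, i).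
Proof.
move=> eaG [e0 Ke0] clK trK Kcont.
pose act (k : G) (e : set_type K) : set_type K :=
  SigSub (mem_set (trK k _ (set_valP e))).
have [] := eaG (set_type K) act.
- by exists (SigSub (mem_set Ke0)).
- exact: closed_subtype_compact (@colouring_compact _ _) clK.
- exact: subtype_hausdorff (@colouring_hausdorff _ _).
- split.
  + move=> e; apply: val_inj; apply/funext => -[g i].
    by rewrite /= /translate /= invg1 mul1g.
  + move=> g h e; apply: val_inj; apply/funext => -[k i].
    by rewrite /= /translate /= invgM mulgA.
  + apply: continuous_comp_initial => -[k0 e]; apply: colouring_cvg => -[g i].
    exists ([set k | forall e, K e ->
          e ((k^-1 * k0 * (k0^-1 * g))%g, i) = e ((k0^-1 * g)%g, i)],
       [set e' | set_val e' ((k0^-1 * g)%g, i) = set_val e ((k0^-1 * g)%g, i)]).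
      split; first exact: (@cvg_mulV1 G k0 _ (Kcont (k0^-1 * g)%g i)).
      exact: (@initial_continuous _ _ (@set_val _ K) e _
        (colouring_near (set_val e) ((k0^-1 * g)%g, i))).
    move=> -[k e'] [/= kE e'E].
    have := kE _ (set_valP e'); rewrite -mulgA mulVKg => e'kE.
    exact: etrans e'kE e'E.
move=> e fixe; exists (set_val e); first exact: set_valP.
move=> g i; have := congr1 (fun e : set_type K => set_val e (g, i)) (fixe g).
by rewrite -[LHS]/(set_val e ((g^-1 * g)%g, i)) mulVg => ->.
Qed.

End Translation.

(** * The cumulative hierarchy and the action of the automorphism group *)

Section Sets.
Variable A : Type.
Implicit Types x y z : vset A.

Lemma veq_refl x : veq x x.
Proof. by elim: x => //= I f IH; split=> i; exists i. Qed.

Lemma veq_sym x y : veq x y -> veq y x.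
Proof.
elim: x y => [a|I f IH] [b|J g] //= [fg gf].
by split=> [j|i]; [have [i] := gf j; exists i|have [j] := fg i; exists j]; exact: IH.
Qed.

Lemma veq_trans y x z : veq x y -> veq y z -> veq x z.
Proof.
elim: x y z => [a|I f IH] [b|J g] [c|K h] //=; first by move=> ->.
move=> [fg gf] [gh hg]; split=> [i|k].
  by have [j fij] := fg i; have [k gjk] := gh j; exists k; exact: IH gjk.
by have [j gjk] := hg k; have [i fij] := gf j; exists i; exact: IH gjk.
Qed.

Lemma vmem_veql x y z : veq x y -> vmem x z -> vmem y z.
Proof. by case: z => //= I f xy [i /(veq_trans (veq_sym xy))]; exists i. Qed.

Lemma vmem_veqr x y z : veq x y -> vmem z x -> vmem z y.
Proof.
case: x y => [a|I f] [b|J g] //= [fg _] [i zfi].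
by have [j /(veq_trans zfi)] := fg i; exists j.
Qed.

Lemma vmem_vpair2 z x y : vmem z (vpair2 x y) <-> veq z x \/ veq z y.
Proof. by split=> [[[] ?]|[?|?]]; [left|right|exists true|exists false]. Qed.

Lemma veq_vpair2 x y x' y' : veq x x' -> veq y y' -> veq (vpair2 x y) (vpair2 x' y').
Proof. by move=> xx yy; split=> -[]; [exists true|exists false|exists true|exists false]. Qed.

Lemma veq_vpair x y x' y' : veq x x' -> veq y y' -> veq (vpair x y) (vpair x' y').
Proof. by move=> xx yy; do 2!apply: veq_vpair2. Qed.

Lemma vpair2I x y x' y' : veq (vpair2 x y) (vpair2 x' y') ->
  [/\ veq x x' \/ veq x y', veq y x' \/ veq y y' & veq x y' \/ veq y y'].
Proof.
move=> xy; split.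
- by apply/vmem_vpair2/(vmem_veqr xy)/vmem_vpair2; left; exact: veq_refl.
- by apply/vmem_vpair2/(vmem_veqr xy)/vmem_vpair2; right; exact: veq_refl.
- have /(vmem_veqr (veq_sym xy)) /vmem_vpair2 : vmem y' (vpair2 x' y').
    by apply/vmem_vpair2; right; exact: veq_refl.
  by case=> /veq_sym; [left|right].
Qed.

Lemma vpair2xxI x y z : veq (vpair2 x x) (vpair2 y z) -> veq x y /\ veq x z.
Proof.
move=> xyz; have [_ _ xz] := vpair2I xyz; have [yx _ _] := vpair2I (veq_sym xyz).
by split; [apply: veq_sym; case: yx|case: xz].
Qed.

Lemma vpairI x y x' y' : veq (vpair x y) (vpair x' y') -> veq x x' /\ veq y y'.
Proof.
move=> xy; have [h1 h2 h3] := vpair2I xy.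
have xx : veq x x' by case: h1 => /vpair2xxI [].
(* Either y = y' directly, or y' = x; in the latter case [h2] gives y = x' or again y = y', and y =
   x' = x = y'. *)
split=> //; have {h3} [/vpair2xxI [_ xy']|/vpair2I [_ _ yy']] := h3; last first.
  case: yy' => // xy'; case: h2 => [/veq_sym /vpair2xxI [_ x'y]|].
    exact: veq_trans (veq_sym x'y) (veq_trans (veq_sym xx) xy').
  move=> /vpair2I [_ [yx'|//] _].
  exact: veq_trans yx' (veq_trans (veq_sym xx) xy').
case: h2 => [/veq_sym /vpair2xxI [_ x'y]|/vpair2I [_ [yx'|//] _]].
  exact: veq_trans (veq_sym x'y) (veq_trans (veq_sym xx) xy').
exact: veq_trans yx' (veq_trans (veq_sym xx) xy').
Qed.

Lemma veq_vtuple k (x y : 'I_k -> vset A) :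
  (forall i, veq (x i) (y i)) -> veq (vtuple x) (vtuple y).
Proof.
move=> xy; rewrite /vtuple; elim: (enum 'I_k) => [|i s IH]; first exact: veq_refl.
exact: veq_vpair.
Qed.

Lemma veq_foldr_vpair (s t : seq (vset A)) :
  veq (foldr (@vpair A) (vempty A) s) (foldr (@vpair A) (vempty A) t) ->
  size s = size t /\ forall i, veq (nth (vempty A) s i) (nth (vempty A) t i).
Proof.
elim: s t => [|x s IH] [|y t].
- by move=> _; split=> // i; rewrite !nth_nil; exact: veq_refl.
- by move=> [_ /(_ true) [[]]].
- by move=> [/(_ true) [[]]].
- by move=> /vpairI [xy /IH [st_size st]]; split=> [|[|i]] //=; rewrite st_size.
Qed.

Lemma vtupleI k k' (x : 'I_k -> vset A) (y : 'I_k' -> vset A) :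
  veq (vtuple x) (vtuple y) ->
  exists e : k = k', forall i, veq (x i) (y (cast_ord e i)).
Proof.
move=> /veq_foldr_vpair []; rewrite (size_map x) (size_map y) !size_enum_ord => e xy; exists e => i.
have nthE m (z : 'I_m -> vset A) (j : 'I_m) :
    nth (vempty A) [seq z l | l <- enum 'I_m] j = z j.
  by rewrite (nth_map j) ?nth_ord_enum // size_enum_ord.
by have := xy i; rewrite nthE -[y _]nthE.
Qed.

(** The list given by [vfinite] may repeat entries or leave [x]. Keeping the least index of each
    entry that lies in [x] removes both defects, so that an element determines its index. *)
Lemma vfinite_enum x : vfinite x ->
  exists (n : nat) (d : 'I_n -> vset A),
    [/\ forall i, vmem (d i) x, forall y, vmem y x -> exists i, veq y (d i) &
        forall i j, veq (d i) (d j) -> i = j].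
Proof.
move=> [n [f fP]].
pose s := [set i : 'I_n | `[< vmem (f i) x >] &&
  [forall j : 'I_n, (j < i) ==> ~~ `[< veq (f j) (f i) >]]].
exists #|s|, (fun i => f (enum_val i)); split.
- by move=> i; have := enum_valP i; rewrite inE => /andP [/asboolP].
- move=> y yx; have [i0 yi0] := fP y yx.
  have [i /asboolP yi imin] := @arg_minnP _ i0 (fun i => `[< veq y (f i) >]) val
    (asboolT yi0).
  suff si : i \in s by exists (enum_rank_in si i); rewrite enum_rankK_in.
  rewrite inE; apply/andP; split; first exact/asboolP/(vmem_veql yi).
  apply/forallP => j; apply/implyP => ji; apply/negP => /asboolP fji.
  have := imin j (asboolT (veq_trans yi (veq_sym fji))).
  by rewrite leqNgt ji.
- move=> i j fij; apply: enum_val_inj; apply/val_inj; apply/eqP.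
  have := enum_valP i; have := enum_valP j.
  rewrite !inE => /andP [_ /forallP jmin] /andP [_ /forallP imin].
  case: ltngtP => // [ij|ji].
    by have := jmin (enum_val i); rewrite ij /= (asboolT fij).
  by have := imin (enum_val j); rewrite ji /= (asboolT (veq_sym fij)).
Qed.

End Sets.

Section Maps.
Variables A B : Type.
Implicit Types x y : vset A.

Lemma veq_vmap (f : A -> B) x y : veq x y -> veq (vmap f x) (vmap f y).
Proof.
elim: x y => [a|I g IH] [b|J h] //=; first by move=> ->.
move=> [gh hg]; split=> [i|j]; first by have [j /IH] := gh i; exists j.
by have [i /IH] := hg j; exists i.
Qed.

Lemma vmem_vmap (f : A -> B) x y : vmem x y -> vmem (vmap f x) (vmap f y).
Proof. by case: y => //= I g [i xgi]; exists i; exact: veq_vmap. Qed.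

Lemma vmap_vpair2 (f : A -> B) x y : vmap f (vpair2 x y) = vpair2 (vmap f x) (vmap f y).
Proof. by congr vsup; apply/funext => -[]. Qed.

Lemma vmap_vpair (f : A -> B) x y : vmap f (vpair x y) = vpair (vmap f x) (vmap f y).
Proof. by rewrite /vpair !vmap_vpair2. Qed.

Lemma vmap_vempty (f : A -> B) : vmap f (vempty A) = vempty B.
Proof. by congr vsup; apply/funext => -[]. Qed.

Lemma vmap_vtuple (f : A -> B) k (x : 'I_k -> vset A) :
  vmap f (vtuple x) = vtuple (fun i => vmap f (x i)).
Proof.
rewrite /vtuple; elim: (enum 'I_k) => [|i s IH]; first exact: vmap_vempty.
by rewrite [LHS]vmap_vpair IH.
Qed.

End Maps.

Lemma vmap_id (A : Type) (x : vset A) : vmap id x = x.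
Proof. by elim: x => //= I f IH; congr vsup; apply/funext. Qed.

Lemma vmap_comp (A B C : Type) (f : B -> C) (g : A -> B) (x : vset A) :
  vmap (f \o g) x = vmap f (vmap g x).
Proof. by elim: x => //= I h IH; congr vsup; apply/funext. Qed.

Section Action.
Variables (L : signature) (A : structure L).
Implicit Types (x y z : vset A) (p q : Aut A).

Lemma vmap1 x : vmap (1%g : Aut A) x = x.
Proof. exact: vmap_id. Qed.

Lemma vmapM p q x : vmap (p * q)%g x = vmap p (vmap q x).
Proof. exact: vmap_comp. Qed.

Lemma vmapK p x : vmap (p^-1)%g (vmap p x) = x.
Proof. by rewrite -vmapM mulVg vmap1. Qed.

Lemma vmapVK p x : vmap p (vmap (p^-1)%g x) = x.
Proof. by rewrite -vmapM mulgV vmap1. Qed.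

Lemma veq_vmapI p x y : veq (vmap p x) (vmap p y) -> veq x y.
Proof. by move=> /(veq_vmap (p^-1)%g); rewrite !vmapK. Qed.

Lemma stabiliser1 x : stabiliser x 1%g.
Proof. by rewrite /stabiliser /mkset vmap1; exact: veq_refl. Qed.

Lemma stabiliserM x p q : stabiliser x p -> stabiliser x q -> stabiliser x (p * q)%g.
Proof.
move=> px qx; rewrite /stabiliser /mkset vmapM.
exact: veq_trans (veq_vmap _ qx) px.
Qed.

Lemma stabiliserV x p : stabiliser x p -> stabiliser x (p^-1)%g.
Proof. by move=> px; apply: (@veq_vmapI p); rewrite vmapVK; exact: veq_sym. Qed.

Lemma stabiliser_veq x y : veq x y -> stabiliser x = stabiliser y.
Proof.
move=> xy; apply/seteqP; split=> p px.
  exact: veq_trans (veq_vmap _ (veq_sym xy)) (veq_trans px xy).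
exact: veq_trans (veq_vmap _ xy) (veq_trans px (veq_sym xy)).
Qed.

Lemma stabiliser_vpair2 x y : stabiliser x `&` stabiliser y `<=` stabiliser (vpair2 x y).
Proof. by move=> p [px py]; rewrite /stabiliser /mkset vmap_vpair2; exact: veq_vpair2. Qed.

(* Inclusion of [p x] in [x] for all [p] gives the other inclusion through [p^-1]. *)
Lemma stabiliser_vsup I (f : I -> vset A) (H : set (Aut A)) :
  (forall p, H p -> H (p^-1)%g) ->
  (forall p i, H p -> exists j, veq (vmap p (f i)) (f j)) ->
  H `<=` stabiliser (vsup f).
Proof.
move=> HV Hf p Hp; split=> /= [i|j]; first exact: Hf.
have [i fij] := Hf _ j (HV _ Hp); exists i; apply: (@veq_vmapI (p^-1)%g).
by rewrite vmapK; exact: veq_sym.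
Qed.

(** A subgroup that is a neighbourhood of 1 is open: for q near p, q^-1 p is in it, hence so is q =
    p (q^-1 p)^-1. *)
Lemma nbhs1_stabiliser_open x : nbhs (1%g : Aut A) (stabiliser x) -> open (stabiliser x).
Proof.
move=> x1; rewrite openE => p px; rewrite /interior.
have x1p : nbhs p [set q | stabiliser x (q^-1 * p)%g] := @cvg_mulV1 (Aut A) p _ x1.
apply: filterS x1p => q /= qpx.
rewrite (_ : q = p * (q^-1 * p)^-1)%g; last by rewrite invgM invgK mulVKg.
by apply: stabiliserM => //; exact: stabiliserV.
Qed.

Lemma symmetric_nbhs1 x : Defs.symmetric x -> nbhs (1%g : Aut A) (stabiliser x).
Proof.
move=> /(_ x (rt_refl _ _ _)) xo; apply: open_nbhs_nbhs; split=> //; exact: stabiliser1.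
Qed.

Lemma symmetric_vmem x y : vmem y x -> Defs.symmetric x -> Defs.symmetric y.
Proof. by move=> yx xs z zy; apply: xs; exact: rt_trans zy (rt_step _ _ _ _ yx). Qed.

Lemma symmetric_veq x y : veq x y -> Defs.symmetric x -> Defs.symmetric y.
Proof.
move=> xy xs z /clos_rt_rtn1_iff zy.
(* The chain from z to y is trivial, or its last link is a membership in y, which is also one in
   x. *)
case: {-1}y / zy (erefl y) => [<-|w v wv zw yv].
  by rewrite -(stabiliser_veq xy); apply: xs; exact: rt_refl.
apply: xs; apply: rt_trans (proj2 (clos_rt_rtn1_iff _ _ _ _) zw) (rt_step _ _ _ _ _).
by apply: vmem_veqr (veq_sym xy) _; rewrite yv.
Qed.

Lemma symmetric_vsup I (f : I -> vset A) :
  nbhs (1%g : Aut A) (stabiliser (vsup f)) -> (forall i, Defs.symmetric (f i)) ->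
  Defs.symmetric (vsup f).
Proof.
move=> f1 fs z /clos_rt_rtn1_iff zf.
case: {-1}(vsup f) / zf (erefl (vsup f)) => [<-|w v wv zw fv].
  exact: nbhs1_stabiliser_open.
have [i wfi] : vmem w (vsup f) by rewrite fv.
exact: (symmetric_veq (veq_sym wfi) (fs i)) (proj2 (clos_rt_rtn1_iff _ _ _ _) zw).
Qed.

End Action.

Section Symmetry.
Variables (L : signature) (A : structure L).
Implicit Types (x y z : vset A) (p q : Aut A) (X : set A).

Lemma symmetric_vatom (a : A) : Defs.symmetric (vatom a).
Proof.
move=> y /clos_rt_rtn1_iff ya; case: {-1}(vatom a) / ya (erefl (vatom a)) => [<-|w v wv _ av].
  by apply: nbhs1_stabiliser_open; exact: (@near_aut _ _ (1%g : Aut A) a).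
by have : vmem w (vatom a) by rewrite av.
Qed.

Lemma symmetric_vpair2 x y :
  Defs.symmetric x -> Defs.symmetric y -> Defs.symmetric (vpair2 x y).
Proof.
move=> xs ys; apply: symmetric_vsup; last by case.
apply: filterS (@stabiliser_vpair2 _ _ x y) _.
by apply: filterI; exact: symmetric_nbhs1.
Qed.

Lemma symmetric_vpair x y :
  Defs.symmetric x -> Defs.symmetric y -> Defs.symmetric (vpair x y).
Proof. by move=> xs ys; do 2!apply: symmetric_vpair2. Qed.

Lemma symmetric_vempty : Defs.symmetric (vempty A).
Proof.
apply: symmetric_vsup => [|[]]; apply: filterS (filterT : nbhs (1%g : Aut A) setT) => p _.
by split=> -[].
Qed.

Lemma symmetric_vtuple k (x : 'I_k -> vset A) :
  (forall i, Defs.symmetric (x i)) -> Defs.symmetric (vtuple x).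
Proof.
move=> xs; rewrite /vtuple; elim: (enum 'I_k) => [|i s IH]; first exact: symmetric_vempty.
exact: symmetric_vpair.
Qed.

Lemma pointwise_stabiliserM X p q : pointwise_stabiliser X p ->
  pointwise_stabiliser X q -> pointwise_stabiliser X (p * q)%g.
Proof. by move=> Xp Xq a Xa; rewrite -[RHS](Xp a Xa) -[in RHS](Xq a Xa). Qed.

Lemma pointwise_stabiliser1 X : pointwise_stabiliser X (1%g : Aut A).
Proof. by []. Qed.

Lemma pointwise_stabiliserV X p :
  pointwise_stabiliser X p -> pointwise_stabiliser X (p^-1)%g.
Proof. by move=> Xp a Xa; rewrite -{1}(Xp a Xa); exact: aut_invK. Qed.

Lemma nbhs1_pointwise_stabiliser X : finite_set X ->
  nbhs (1%g : Aut A) (pointwise_stabiliser X).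
Proof.
move=> /(@finite_seqP {classic A}) [s sE]; rewrite sE => {X sE}.
elim: s => [|a s IH]; first by apply: filterS filterT => p _ a.
apply: filterS2 (@near_aut _ _ (1%g : Aut A) a) IH => p pa ps b.
by rewrite /= inE => /orP [/eqP ->|]; [exact: pa|exact: ps].
Qed.

End Symmetry.

(** * Equivariant solutions from extreme amenability *)

Section EquivariantSolution.
Variables (L : signature) (A : structure L).

(** [csp_conP] provides some decomposition of the constraint; unique readability of pairs and tuples
    carries it over to the given one. *)
Lemma csp_con_var (P : csp A) k (x : 'I_k -> vset A) R :
  vmem (vpair (vtuple x) R) (csp_con P) -> forall i, vmem (x i) (csp_var P).
Proof.
move=> /(@csp_conP _ P) [k' [x' [R' [x'V _ /vpairI [/vtupleI [e xx'] _]]]]] i.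
exact: vmem_veql (veq_sym (xx' i)) (x'V _).
Qed.

Lemma equivariant_solution (X : set A) (P : csp A) (S0 : vset A) :
  extremely_amenable (Aut A) -> finite_set X -> equivariant_csp X P ->
  vfinite (csp_dom P) -> is_solution P S0 ->
  exists S, is_solution P S /\ equivariant X S.
Proof.
move=> eaA finX [[Dsym DX] [Vsym VX] [Csym CX]] finD [S0fun S0sol].
have [n [d [dD dcov dI]]] := vfinite_enum finD.
have := @csp_var_set _ P; case Vdef : (csp_var P) => [//|I f] _.
have fV i : vmem (f i) (csp_var P) by rewrite Vdef; exists i; exact: veq_refl.
have Vf x : vmem x (csp_var P) -> exists i, veq x (f i) by rewrite Vdef.
set H := pointwise_stabiliser X in DX VX CX *.
have moves Y p x : (H `<=` stabiliser Y) -> H p -> vmem x Y -> vmem (vmap p x) Y.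
  by move=> HY Hp /(vmem_vmap p); apply: vmem_veqr; exact: HY.
(* With e_g (f i) = d (e (g, i)), [C1] says that e_(gh) = h^-1 e_g for h in H; the case h = 1 makes
   e_g independent of the index naming a variable. [C2] says that each e_g meets the constraints. *)
pose C1 (e : colouring (Aut A * I) n) := forall g h i i', H h ->
  veq (f i) (vmap h (f i')) -> veq (d (e (g, i))) (vmap h (d (e ((g * h)%g, i')))).
pose C2 (e : colouring (Aut A * I) n) := forall g k (idx : 'I_k -> I) R,
  vmem (vpair (vtuple (fun l => f (idx l))) R) (csp_con P) ->
  vmem (vtuple (fun l => d (e (g, idx l)))) R.
have [] := @extremely_amenable_colouring (Aut A) I n [set e | C1 e /\ C2 e] eaA.
(* Non-emptiness: [coset g] is g H and [r g] a representative depending only on it. With t = (r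
   g)^-1 g in H, take e_g = t^-1 S0. *)
- pose coset (g : Aut A) := [set k : Aut A | H (k^-1 * g)%g].
  have cosetM g h : H h -> coset (g * h)%g = coset g.
    move=> Hh; apply/seteqP; split=> k; rewrite /coset /= mulgA; last first.
      by move=> ?; exact: pointwise_stabiliserM.
    move=> /pointwise_stabiliserM /(_ (pointwise_stabiliserV Hh)).
    by rewrite mulgK.
  pose r g : Aut A := xget (1%g : Aut A) (coset g).
  have rP g : H ((r g)^-1 * g)%g.
    apply: (@xgetPex _ (1%g : Aut A) (coset g)); exists g.
    by rewrite /coset /= mulVg; exact: pointwise_stabiliser1.
  have rM g h : H h -> r (g * h)%g = r g by move=> Hh; rewrite /r cosetM.
  have [S0set S0sub S0tot S0uniq] := S0fun.
  have ex (j : Aut A * I) : exists l, let t := ((r j.1)^-1 * j.1)%g in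
      vmem (vpair (vmap t (f j.2)) (vmap t (d l))) S0.
    set t := ((r j.1)^-1 * j.1)%g; have Ht : H t := rP _.
    have [y yS] := S0tot _ (moves _ _ _ VX Ht (fV j.2)).
    have yD : vmem y (csp_dom P).
      have [x' [y' [_ y'D /vpairI [_ yy']]]] := S0sub _ yS.
      exact: vmem_veql (veq_sym yy') y'D.
    have [l yl] := dcov _ (moves _ _ _ DX (pointwise_stabiliserV Ht) yD).
    exists l; apply: vmem_veql yS; apply: veq_vpair; first exact: veq_refl.
    by apply: (@veq_vmapI _ _ (t^-1)%g); rewrite vmapK.
  pose e0 : colouring (Aut A * I) n := fun j => projT1 (cid (ex j)).
  have e0P g i : vmem (vpair (vmap ((r g)^-1 * g)%g (f i))
      (vmap ((r g)^-1 * g)%g (d (e0 (g, i))))) S0 := projT2 (cid (ex (g, i))).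
  exists e0; split.
  + move=> g h i i' Hh fi; have := e0P (g * h)%g i'; rewrite rM // mulgA => ghS.
    apply: (@veq_vmapI _ _ ((r g)^-1 * g)%g); rewrite -vmapM.
    apply: S0uniq (e0P g i) _; apply: vmem_veql ghS.
    apply: veq_vpair; last exact: veq_refl.
    by rewrite vmapM; apply: veq_vmap; exact: veq_sym.
  + move=> g k idx R /(moves _ _ _ CX (rP g)); rewrite vmap_vpair vmap_vtuple.
    move=> /S0sol [d' [d'S d'R]].
    rewrite -(vmapK ((r g)^-1 * g)%g R) -(vmapK ((r g)^-1 * g)%g (vtuple _)).
    apply: vmem_vmap; rewrite vmap_vtuple; apply: vmem_veql d'R.
    by apply: veq_vtuple => l; exact: S0uniq (d'S l) (e0P _ _).
(* Each instance of [C1] reads two values of e, each instance of [C2] reads k values. *)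
- apply: colouring_closed => e eP; split.
  + move=> g h i i' Hh fi.
    have [e' [e'1 _] e'E] := eP 2 (fun l => if val l is 0 then (g, i) else ((g * h)%g, i')).
    have := e'1 g h i i' Hh fi; rewrite (e'E ord0).
    by have /= -> := e'E (lift ord0 ord0).
  + move=> g k idx R CR; have [e' [_ e'2] e'E] := eP k (fun l => (g, idx l)).
    rewrite (_ : (fun l => _) = fun l => d (e' (g, idx l))); first exact: e'2.
    by apply/funext => l; rewrite e'E.
(* Left translation commutes with right multiplication by h. *)
- move=> k e [e1 e2]; split=> [g h i i' Hh fi|g m idx R CR]; last first.
    exact: (e2 (k^-1 * g)%g) CR.
  by rewrite /translate /= mulgA; exact: e1.
- move=> g i.
  (* For u near 1, h = g^-1 u g lies in H and fixes f i and every d j. As u g = g h, [C1] gives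
     equal values at (g, i) and (u g, i), whatever e is. *)
  have U1 : nbhs (1%g : Aut A)
      [set h | H h /\ (stabiliser (f i) h /\ forall j, stabiliser (d j) h)].
    apply: filterI; first exact: nbhs1_pointwise_stabiliser.
    apply: filterI; first exact/symmetric_nbhs1/(symmetric_vmem (fV i)).
    exact: (@filter_forall _ 'I_n (fun j => stabiliser (d j)) _ _
      (fun j => symmetric_nbhs1 (symmetric_vmem (dD j) Dsym))).
  have U2 : nbhs (1%g : Aut A) _ := @cvg_conj1 (Aut A) g _ U1.
  apply: filterS U2 => u [/= Hh [fh dh]] e [e1 _].
  have := e1 g _ i i Hh (veq_sym fh).
  rewrite -mulgA mulVKg => /veq_trans /(_ (dh _)) /dI.
  by move=> ->.
move=> e [e1 e2] e_const.
pose s i := e (1%g, i).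
have sE h i i' : H h -> veq (f i) (vmap h (f i')) -> veq (d (s i)) (vmap h (d (s i'))).
  by move=> Hh fi; rewrite /s -(e_const (1 * h)%g i'); exact: e1.
pose S := vsup (fun i => vpair (f i) (d (s i))).
have HS : H `<=` stabiliser S.
  apply: stabiliser_vsup; first exact: pointwise_stabiliserV.
  move=> p i Hp; have [j fj] := Vf _ (moves _ _ _ VX Hp (fV i)).
  exists j; rewrite vmap_vpair; apply: veq_vpair => //.
  by apply: veq_sym; apply: sE => //; exact: veq_sym.
exists S; split; last first.
  split=> //; apply: symmetric_vsup.
    exact: filterS HS (nbhs1_pointwise_stabiliser finX).
  move=> i; apply: symmetric_vpair; first exact: symmetric_vmem (fV i) Vsym.
  exact: symmetric_vmem (dD _) Dsym.
split; first split=> //.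
- by move=> p [i pi]; exists (f i), (d (s i)).
- move=> x /Vf [i xi]; exists (d (s i)), i.
  by apply: veq_vpair => //; exact: veq_refl.
- move=> x y z [i /vpairI [xi yi]] [j /vpairI [xj zj]].
  apply: veq_trans yi (veq_trans _ (veq_sym zj)).
  rewrite -[d (s j)](@vmap1 _ A); apply: sE; first exact: pointwise_stabiliser1.
  by rewrite vmap1; exact: veq_trans (veq_sym xi) xj.
- move=> k x R xR.
  have /choice [idx xE] : forall l, exists i, veq (x l) (f i).
    by move=> l; apply: Vf; exact: csp_con_var xR l.
  exists (fun l => d (s (idx l))); split.
    by move=> l; exists (idx l); apply: veq_vpair => //; exact: veq_refl.
  apply: e2; apply: vmem_veql xR; apply: veq_vpair; last exact: veq_refl.
  exact: veq_vtuple.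
Qed.

End EquivariantSolution.

(** * Extreme amenability from equivariant solutions *)

Section Numerals.

(** Zermelo numerals. They contain no atoms, so colours are fixed by every automorphism. *)
Fixpoint vnat (A : Type) (n : nat) : vset A :=
  if n is m.+1 then vpair2 (vnat A m) (vnat A m) else vempty A.

Lemma vnat_inj (A : Type) m n : veq (vnat A m) (vnat A n) -> m = n.
Proof.
elim: m n => [|m IH] [|n] //.
- by move=> [_ /(_ true) [[]]].
- by move=> [/(_ true) [[]]].
- by move=> /vpair2xxI [/IH ->].
Qed.

Lemma vmap_vnat (A B : Type) (f : A -> B) n : vmap f (vnat A n) = vnat B n.
Proof.
elim: n => [|n IH]; first exact: vmap_vempty.
by rewrite [LHS]vmap_vpair2 IH.
Qed.

Lemma symmetric_vnat (L : signature) (A : structure L) n : Defs.symmetric (vnat A n).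
Proof.
elim: n => [|n IH]; first exact: symmetric_vempty.
exact: symmetric_vpair2.
Qed.

End Numerals.

Definition ord2 (T : Type) (x y : T) (l : 'I_2) : T := if val l is 0 then x else y.

Lemma ord2_comp (T U : Type) (f : T -> U) x y : (fun l => f (ord2 x y l)) = ord2 (f x) (f y).
Proof. by apply/funext => -[[]]. Qed.

(** * Neighbourhoods of the identity and actions on compact spaces *)

Section Neighbourhoods.
Variables (L : signature) (A : structure L).

(** The sets containing the pointwise stabiliser of a finite set form a filter, and its convergence
    to 1 can be checked one atom at a time. *)
Lemma nbhs1_Aut (U : set (Aut A)) : nbhs (1%g : Aut A) U ->
  exists2 X : set A, finite_set X & pointwise_stabiliser X `<=` U.
Proof.
pose F : set_system (Aut A) := fun U =>
  exists2 X : set A, finite_set X & pointwise_stabiliser X `<=` U.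
have FF : Filter F.
  split; first by exists set0.
  - move=> V W [X finX XV] [Y finY YW]; exists (X `|` Y).
      by rewrite finite_setU.
    by move=> p XYp; split; [apply: XV|apply: YW] => a Xa; apply: XYp; [left|right].
  - by move=> V W VW [X finX XV]; exists X => //; exact: subset_trans XV VW.
suff : F --> (1%g : Aut A) by apply.
suff F1 : (@aut_to_prod _ A) @ F --> aut_to_prod (1%g : Aut A).
  move=> V [_ [[W oW <-] /= W1] WV]; apply: filterS WV _.
  by apply: F1; exact: open_nbhs_nbhs.
apply/cvg_sup => a V [/= _ [[W oW <-] /= W1 WV]].
exists [set a]; first exact: finite_set1.
by move=> p /(_ a erefl) pa; apply: WV; rewrite /= /proj /= /aut_to_prod pa.
Qed.

(** Take for [v] the tuple listing a finite set of atoms: an automorphism fixing the tuple fixes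
    each of its entries. *)
Lemma nbhs1_tuple (U : set (Aut A)) : nbhs (1%g : Aut A) U ->
  exists2 v : vset A, forall p : Aut A, Defs.symmetric (vmap p v) & stabiliser v `<=` U.
Proof.
move=> /nbhs1_Aut [X /(@finite_seqP {classic A}) [s XE] XU].
pose a (i : 'I_(size s)) : A := tnth (in_tuple s) i.
exists (vtuple (fun i => vatom (a i))) => p.
  by rewrite vmap_vtuple; apply: symmetric_vtuple => i; exact: symmetric_vatom.
rewrite /stabiliser /mkset vmap_vtuple => /vtupleI [e pa]; apply: XU => b.
rewrite XE => bs; have /tnthP [i ->] : b \in in_tuple s := bs.
by have /= := pa i; rewrite cast_ord_id.
Qed.

End Neighbourhoods.

(* [y \in s] would put the carrier of [T] below the universe of [predArgType],
   after which ['I_n] could no longer index a [vset]. *)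
Lemma compact_finite_cover (T : topologicalType) (U : T -> set T) :
  compact [set: T] -> (forall x, nbhs x (U x)) ->
  exists s : seq T, forall x, exists2 y, List.In y s & U y x.
Proof.
move=> /compact_near_coveringP cT Unbhs.
pose F : set_system (seq T) := fun B =>
  exists s0 : seq T, forall s : seq T, List.incl s0 s -> B s.
have FF : Filter F.
  split; first by exists [::].
  - move=> B C [s sB] [t tC]; exists (s ++ t) => r str; split.
      by apply: sB => x xs; apply: str; apply/List.in_app_iff; left.
    by apply: tC => x xt; apply: str; apply/List.in_app_iff; right.
  - by move=> B C BC [s sB]; exists s => t st; apply: BC; exact: sB.
have [s0 s0P] : F [set s | forall x, [set: T] x -> exists2 y, List.In y s & U y x].
  apply: (cT _ F (fun s x => exists2 y, List.In y s & U y x)) => x _.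
  exists (U x, [set s | List.In x s]).
    by split; [exact: Unbhs|exists [:: x] => s /(_ x (or_introl erefl))].
  by move=> [z s] [/= Uxz xs]; exists x.
by exists s0 => x; apply: s0P.
Qed.

(** If g moves x, separate x from g x by disjoint open sets B and C; then g sends the intersection
    of B and g^-1 C off itself. Finitely many such sets cover T. *)
Lemma action_displacing_cover (G : topologicalGroupType) (T : topologicalType)
    (act : G -> T -> T) : [set: T] !=set0 ->
  compact [set: T] -> hausdorff_space T -> continuous_action act ->
  (forall x, exists g, act g x <> x) ->
  exists (n : nat) (U : 'I_n -> set T) (g : 'I_n -> G),
    [/\ forall i, open (U i), forall x, exists i, U i x &
        forall i x, U i x -> ~ U i (act (g i) x)].
Proof.
move=> [x0 _] cT hT actP moved.
have act_cont g : continuous (act g).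
  move=> x; apply: (@continuous_comp _ _ _ (pair g) (fun gx : G * T => act gx.1 gx.2)).
    by apply: cvg_pair; [exact: cvg_cst|exact: cvg_id].
  exact: act_continuous.
have /choice [gU gUP] (x : T) : exists gU : G * set T,
    [/\ open gU.2, gU.2 x & forall y, gU.2 y -> ~ gU.2 (act gU.1 y)].
  have [g gx] := moved x; have xg : x != act g x by apply/eqP => /esym.
  have := hT; rewrite open_hausdorff => /(_ _ _ xg) [[B C] /=].
  rewrite !inE => -[Bx Cgx] [oB oC] BC.
  exists (g, B `&` act g @^-1` C); split.
  - by apply: openI => //; apply: open_comp oC => y _; exact: act_cont.
  - by [].
  - by move=> y [_ Cgy] [Bgy _]; have : (B `&` C) (act g y) by []; rewrite BC.
have [|s scov] := @compact_finite_cover T (fun x => (gU x).2) cT.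
  by move=> x; have [oU Ux _] := gUP x; exact: open_nbhs_nbhs.
pose y (i : 'I_(List.length s)) := List.nth i s x0.
exists (List.length s), (fun i => (gU (y i)).2), (fun i => (gU (y i)).1); split.
- by move=> i; have [] := gUP (y i).
- move=> x; have [z /(List.In_nth _ _ x0) [k [/ltP ks <-]] Uzx] := scov x.
  by exists (Ordinal ks).
- by move=> i x; have [_ _] := gUP (y i); apply.
Qed.

(** Continuity at (1, x) gives neighbourhoods N of 1 and W of x with N W inside some U_i;
    compactness makes one N work for all x. *)
Lemma action_lebesgue_number (G : topologicalGroupType) (T : topologicalType)
    (act : G -> T -> T) (I : Type) (U : I -> set T) :
  compact [set: T] -> continuous_action act ->
  (forall i, open (U i)) -> (forall x, exists i, U i x) ->
  exists2 N : set G, nbhs (1%g : G) N &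
    forall x, exists i, forall h, N h -> U i (act h x).
Proof.
move=> /compact_near_coveringP cT actP oU covU.
have small : \forall N \near powerset_filter_from (nbhs (1%g : G)),
    forall x, [set: T] x -> exists i, forall h, N h -> U i (act h x).
  apply: cT => x _; have [i Uix] := covU x.
  have : nbhs (1%g : G, x) [set hy : G * T | U i (act hy.1 hy.2)].
    apply: (@act_continuous _ _ _ actP (1%g, x)).
    by apply: open_nbhs_nbhs; split => //=; rewrite (act1 actP).
  move=> [[N W] /= [N1 Wx] NWU]; exists (W, [set M | M `<=` N]).
    by split => //; exact: small_set_sub.
  by move=> [y M] [/= Wy MN]; exists i => h /MN Nh; exact: (NWU (h, y)).
have [N [N1 NU]] := filter_ex (filterI (near_small_set _) small).
by exists N => // x; exact: NU.
Qed.

(** * The constraint problem of a displacing cover *)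

Section Necessity.
Variables (L : signature) (A : structure L).

Section DisplacementCSP.
Variables (n : nat) (v : vset A) (g : 'I_n -> Aut A).
Hypothesis v_sym : forall p : Aut A, Defs.symmetric (vmap p v).

Definition displacement_dom : vset A := vsup (fun i : 'I_n => vnat A i).

(** A single orbit, so that an invariant solution with numeral values has to be constant. *)
Definition displacement_var : vset A := vsup (fun p : Aut A => vmap p v).

Definition displacement_rel (j : 'I_n) : vset A :=
  vsup (fun ab : {ab : 'I_n * 'I_n | ~ (ab.1 = j /\ ab.2 = j)} =>
    vtuple (ord2 (vnat A (sval ab).1) (vnat A (sval ab).2))).

(** [(g j)^-1] multiplies on the right, so left multiplication by automorphisms permutes the
    constraints. *)
Definition displacement_con : vset A :=
  vsup (fun pj : Aut A * 'I_n =>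
    vpair (vtuple (ord2 (vmap pj.1 v) (vmap (pj.1 * (g pj.2)^-1)%g v)))
          (displacement_rel pj.2)).

Definition displacement_csp : csp A.
Proof.
refine (@CSP A displacement_dom displacement_var displacement_con _ _ _ _) => //.
move=> c [[p j] cE]; do 3!eexists; split; last exact: cE.
  move=> [[|l] li]; [exists p|exists (p * (g j)^-1)%g]; exact: veq_refl.
split=> // t [ab tE]; eexists; split; last exact: tE.
by move=> [[|l] li]; [exists (sval ab).1|exists (sval ab).2]; exact: veq_refl.
Defined.

Lemma vmap_displacement_rel p j : vmap p (displacement_rel j) = displacement_rel j.
Proof.
congr vsup; apply/funext => ab; apply: etrans (vmap_vtuple _ _) _.
by rewrite ord2_comp !vmap_vnat.
Qed.

Lemma equivariant_vsup I (f : I -> vset A) (X : set A) :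
  (forall (p : Aut A) i, exists j, veq (vmap p (f i)) (f j)) -> (forall i, Defs.symmetric (f i)) ->
  equivariant X (vsup f).
Proof.
move=> fp fs; have fS (p : Aut A) : stabiliser (vsup f) p.
  by apply: (@stabiliser_vsup _ _ I f setT) => // q i _; exact: fp.
split; last by move=> p _; exact: fS.
by apply: symmetric_vsup => //; apply: filterS filterT.
Qed.

Lemma displacement_equivariant X : equivariant_csp X displacement_csp.
Proof.
split; apply: equivariant_vsup.
- by move=> p i; exists i; rewrite vmap_vnat; exact: veq_refl.
- by move=> i; exact: symmetric_vnat.
- by move=> p q; exists (p * q)%g; rewrite vmapM; exact: veq_refl.
- exact: v_sym.
- move=> p [q j]; exists ((p * q)%g, j).
  rewrite [X in veq X _]vmap_vpair vmap_vtuple ord2_comp vmap_displacement_rel.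
  by rewrite -!vmapM mulgA; exact: veq_refl.
- move=> [p j]; apply: symmetric_vpair.
    by apply: symmetric_vtuple => -[[|l] li]; exact: v_sym.
  suff [] : equivariant set0 (displacement_rel j) by [].
  apply: equivariant_vsup => [q ab|ab].
    by exists ab; rewrite [X in veq X _]vmap_vtuple ord2_comp !vmap_vnat; exact: veq_refl.
  by apply: symmetric_vtuple => -[[|l] li]; exact: symmetric_vnat.
Qed.

Lemma displacement_vfinite : vfinite (csp_dom displacement_csp).
Proof. by exists n, (fun i => vnat A i) => y [i]; exists i. Qed.

(** The first hypothesis lets [c] descend from automorphisms to points of the orbit; the second is
    what the constraints demand. *)
Lemma displacement_solution (c : Aut A -> 'I_n) :
  (forall p q : Aut A, veq (vmap p v) (vmap q v) -> c p = c q) ->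
  (forall p j, ~ (c p = j /\ c (p * (g j)^-1)%g = j)) ->
  is_solution displacement_csp (vsup (fun p : Aut A => vpair (vmap p v) (vnat A (c p)))).
Proof.
move=> cv cg; split; first split=> //.
- move=> t [p tE]; exists (vmap p v), (vnat A (c p)).
  by split=> //; [exists p|exists (c p)]; exact: veq_refl.
- move=> x [p xE]; exists (vnat A (c p)), p; apply: veq_vpair => //; exact: veq_refl.
- move=> x y z [p /vpairI [xp yp]] [q /vpairI [xq zq]].
  apply: veq_trans yp (veq_sym _); apply: veq_trans zq _.
  rewrite (cv p q); first exact: veq_refl.
  exact: veq_trans (veq_sym xp) xq.
- move=> k x R [[p j] /= /vpairI [/vtupleI [e xE] RE]]; subst k.
  pose pl := ord2 p (p * (g j)^-1)%g.
  exists (fun l => vnat A (c (pl l))); split.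
    move=> l; exists (pl l); apply: veq_vpair; last exact: veq_refl.
    apply: veq_trans (xE l) _; rewrite cast_ord_id.
    by case: l => -[|l] li; exact: veq_refl.
  apply: vmem_veqr (veq_sym RE) _.
  exists (exist _ (c p, c (p * (g j)^-1)%g) (cg p j)).
  by rewrite (ord2_comp (fun q => vnat A (c q))); exact: veq_refl.
Qed.

(** Invariance carries the value j at v to every p v, since numerals are fixed. The constraint
    indexed by (1, j) then receives the excluded pair (j, j). *)
Lemma displacement_no_equivariant_solution S :
  is_solution displacement_csp S -> ~ equivariant set0 S.
Proof.
move=> [[_ Ssub Stot Suniq] Ssol] [_ Seq].
have vV : vmem v displacement_var by exists 1%g; rewrite vmap1; exact: veq_refl.
have [y vyS] := Stot v vV; have [x' [y' [_ [j yj] /vpairI [_ yy]]]] := Ssub _ vyS.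
have Sj (p : Aut A) : vmem (vpair (vmap p v) (vnat A j)) S.
  have pS : stabiliser S p by apply: Seq => a [].
  have := vmem_veqr pS (vmem_vmap p vyS).
  apply: vmem_veql; rewrite vmap_vpair; apply: veq_vpair; first exact: veq_refl.
  by rewrite -(vmap_vnat p); apply: veq_vmap; exact: veq_trans yy yj.
have [|d [dS [ab /vtupleI [e dab]]]] := Ssol 2
    (ord2 (vmap (1%g : Aut A) v) (vmap (1 * (g j)^-1)%g v)) (displacement_rel j).
  by exists (1%g, j); exact: veq_refl.
have dj l : veq (d l) (vnat A j).
  have := dS l; case: l => -[|l] li lS.
    exact: Suniq lS (Sj 1%g).
  exact: Suniq lS (Sj (1 * (g j)^-1)%g).
case: ab dab => -[a b] /= abj dab; apply: abj; split; apply: val_inj; apply: (@vnat_inj A).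
  by have := dab ord0; rewrite cast_ord_id => /veq_sym /veq_trans /(_ (dj _)).
by have := dab ord_max; rewrite cast_ord_id => /veq_sym /veq_trans /(_ (dj _)).
Qed.

End DisplacementCSP.

Lemma ZFA_axiom_CSP_extremely_amenable : ZFA_axiom_CSP A -> extremely_amenable (Aut A).
Proof.
move=> axA T act T0 cT hT actP.
apply: contrapT => /forallNP nofix.
have [] := action_displacing_cover T0 cT hT actP.
  by move=> x; apply/existsNP => fixx; exact: nofix x fixx.
move=> n [U [g [oU covU Ug]]].
have [N N1 NU] := action_lebesgue_number cT actP oU covU.
have [v v_sym vN] := nbhs1_tuple N1.
have [x0 _] := T0.
(* The admissible colours of p v. [Q p] is non-empty by the choice of N, so the default [i0] below
   is never returned. *)
pose Q (p : Aut A) := [set i | forall h, stabiliser v h -> U i (act (h * p^-1)%g x0)].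
have [i0 _] := covU x0.
pose c (p : Aut A) : 'I_n := xget i0 (Q p).
have cP (p : Aut A) : Q p (c p).
  apply: xgetPex; have [i Ni] := NU (act (p^-1)%g x0).
  by exists i => h /vN /Ni; rewrite (actM actP).
(* If p v = q v then q^-1 p stabilises v, so p^-1 x0 and q^-1 x0 have the same orbit under the
   stabiliser; [Q p] and [Q q] are then equal sets, and [xget] picks the same element. *)
have cv (p q : Aut A) : veq (vmap p v) (vmap q v) -> c p = c q.
  suff QQ (p' q' : Aut A) : veq (vmap p' v) (vmap q' v) -> Q p' `<=` Q q'.
    move=> pq; rewrite /c (_ : Q p = Q q) //.
    by apply/seteqP; split; apply: QQ => //; exact: veq_sym.
  move=> pq i Qi h hv.
  rewrite (_ : (h * q'^-1 = h * (q'^-1 * p') * p'^-1)%g); last by rewrite -mulgA mulgK.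
  apply: Qi; apply: stabiliserM => //; apply: (@veq_vmapI _ _ q').
  by rewrite -vmapM mulVKg.
(* Otherwise, with h = 1, both y = p^-1 x0 and (p g_j^-1)^-1 x0 = g_j y would lie in U_j. *)
have cg (p : Aut A) j : ~ (c p = j /\ c (p * (g j)^-1)%g = j).
  move=> [pj qj]; have := cP p 1%g (stabiliser1 _); rewrite pj mul1g => Up.
  have := cP (p * (g j)^-1)%g 1%g (stabiliser1 _).
  by rewrite qj mul1g invgM invgK (actM actP); exact: Ug.
(* For X empty, the axiom turns the colouring into a solution invariant under the whole group. *)
have [_ /(_ (ex_intro _ _ (displacement_solution cv cg)))] :=
  axA set0 (finite_set0 _) _ (displacement_equivariant g v_sym set0)
   (displacement_vfinite _ _).
by move=> [S [Ssol Seq]]; exact: displacement_no_equivariant_solution Ssol Seq.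
Qed.

End Necessity.

Theorem theorem3p4 (L : signature) (A : structure L) (hA : countable [set: A]) :
  ZFA_axiom_CSP A <-> extremely_amenable (Aut A).
Proof.
split; first exact: ZFA_axiom_CSP_extremely_amenable.
move=> eaA X finX P Peq finD; split=> [[S [Ssol _]]|[S0 S0sol]]; first by exists S.
exact: equivariant_solution eaA finX Peq finD S0sol.
Qed.
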